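(* Let $(\mathcal X,\rho)$ be a non-empty Polish metric space with Borel $\sigma$-field $\mathfrak B(\mathcal X)$, and let $\mathcal Y\in\mathfrak B(\mathcal X)$ be compact and satisfy $$c_{x,0}\,s^{-\gamma}\le \log \mathcal N_{\mathcal X}(s,\mathcal Y,\rho)\le c_{x,1}\,s^{-\gamma}\qquad\text{for all } s\in(0,s_0),$$ for constants $s_0>0$, $0<c_{x,0}<c_{x,1}$, $\gamma>0$. Fix $C>0$, $\beta\in(0,1]$, and let $\mathcal G=\mathcal G_{\beta,C}$ be the class of Borel measurable $g:\mathcal X\to\mathbb R$ with $\sup_{y\in\mathcal Y}|g(y)|\le C$ and $|g(y)-g(z)|\le C\rho(y,z)^\beta$ for all $y,z\in\mathcal Y$. For each $n$ consider the model $Y_j=g(X_j)+\varepsilon_j$, $j=1,\dots,n$, where $g\in\mathcal G$, $X_1,\dots,X_n$ are i.i.d. with law $P_{X,n}$ on $\mathfrak B(\mathcal X)$, $P_{X,n}(\mathcal Y)=1$, the $\varepsilon_j$ are i.i.d. real random variables with a continuously differentiable density $f_\varepsilon$ satisfying $\int |f_\varepsilon'(x)|^2/f_\varepsilon(x)\,\mathrm dx<\infty$, and $X_1,\varepsilon_1,\dots,X_n,\varepsilon_n$ are all independent. An estimator $\hat g_n$ is a Borel measurable map $(x,\mathcal Z_n)\mapsto \hat g_n(x,\mathcal Z_n)\in\mathbb R$ of $x\in\mathcal X$ and the data $\mathcal Z_n=\{(X_1,Y_1),\dots,(X_n,Y_n)\}$. (a) There exists a sequence of design measures $P_{X,n}$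 on $\mathfrak B(\mathcal X)$ with $P_{X,n}(\mathcal Y)=1$ for all $n$ such that no sequence of estimators $\{\hat g_n\}_n$ satisfies $$\sup_{g\in\mathcal G}\int E|\hat g_n(x)-g(x)|^2\,\mathrm dP_{X,n}(x)=o\big(\{\log n\}^{-2\beta/\gamma}\big).$$ (b) For any sequence of design measures $P_{X,n}$ with $P_{X,n}(\mathcal Y)=1$ for all $n$ and any sequence of estimators $\{\hat g_n\}_n$, $$\liminf_{n\to\infty}\sup_{g\in\mathcal G}\sup_{x\in\mathcal Y}P\big[|\hat g_n(x)-g(x)|^2>c\{\log n\}^{-2\beta/\gamma}\big]>0$$ for some constant $c>0$ depending on $C$ and $\beta$.
   Context: $\mathcal N_{\mathcal X}(\delta,\mathcal Y,\rho)$ denotes the minimal number of open $\rho$-balls in $\mathcal X$ of radius $\delta$ whose union contains $\mathcal Y$. Probabilities and expectations are under the model with regression function $g$. *)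

(* Defs.v *)
From HB Require Import structures.
From mathcomp Require Import all_boot all_order all_algebra.
From mathcomp Require Import all_classical all_reals all_analysis.
Set Implicit Arguments. Unset Strict Implicit. Unset Printing Implicit Defensive.
Import Order.TTheory GRing.Theory Num.Theory.
Import numFieldNormedType.Exports.
Local Open Scope classical_set_scope.
Local Open Scope ring_scope.

Section defs.
Context {R : realType} {d : measure_display} {X : measurableType d}.
Variable rho : X -> X -> R.

Definition is_metric : Prop :=
  [/\ forall x y, 0 <= rho x y,
      forall x y, rho x y = 0 <-> x = y,
      forall x y, rho x y = rho y x &
      forall x y z, rho x z <= rho x y + rho y z].

Definition rho_ball (c : X) (r : R) : set X := [set y | rho c y < r].

Definition rho_open (A : set X) : Prop :=
  forall x, A x -> exists2 r : R, 0 < r & rho_ball x r `<=` A.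

Definition rho_complete : Prop :=
  forall u : nat -> X,
    (forall e : R, 0 < e -> exists N, forall m n, (N <= m)%N -> (N <= n)%N ->
        rho (u m) (u n) < e) ->
    exists l : X, forall e : R, 0 < e -> exists N, forall n, (N <= n)%N ->
        rho (u n) l < e.

Definition rho_separable : Prop :=
  exists u : nat -> X, forall x (e : R), 0 < e -> exists k, rho x (u k) < e.

Definition polish : Prop := rho_complete /\ rho_separable.

Definition borel_space : Prop := @measurable d X = <<s rho_open >>.

Definition rho_compact (Y : set X) : Prop :=
  forall (I : Type) (U : I -> set X), (forall i, rho_open (U i)) ->
    Y `<=` \bigcup_i U i ->
    exists2 F : set I, finite_set F & Y `<=` \bigcup_(i in F) U i.

Definition covered_by (delta : R) (Y : set X) (k : nat) : Prop :=
  exists c : 'I_k -> X, Y `<=` \bigcup_(i in [set: 'I_k]) rho_ball (c i) delta.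

Definition covering_number (delta : R) (Y : set X) : nat :=
  match pselect (exists k, `[< covered_by delta Y k >]) with
  | left H => ex_minn H
  | right _ => 0%N
  end.

Definition holder_class (Y : set X) (beta C : R) : set (X -> R) :=
  [set g | [/\ measurable_fun setT (g : X -> R),
              forall y, Y y -> `|g y| <= C &
              forall y z, Y y -> Y z -> `|g y - g z| <= C * rho y z `^ beta]].
End defs.

Section sample.
Context {R : realType} {d : measure_display} {X : measurableType d}.

(* E[h(Z_m)] where Z_m = ((X_1,Y_1),...,(X_m,Y_m)), X_j iid ~ P,
   Y_j = g X_j + eps_j, eps_j iid with Lebesgue density f, all independent
   (iterated integral over the product law) *)
Fixpoint sample_expect (P : {measure set X -> \bar R}) (g : X -> R) (f : R -> R)
  (m : nat) : (m.-tuple (X * R) -> \bar R) -> \bar R :=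
  match m with
  | 0%N => fun h => h [tuple]
  | m'.+1 => fun h =>
      (\int[P]_x \int[@lebesgue_measure R]_e
         ((f e)%:E * sample_expect P g f
             (fun t : m'.-tuple (X * R) => h [tuple of (x, (g x + e)%R) :: t])))%E
  end.
End sample.

(* Main.v *)
Require Import Defs.
From HB Require Import structures.
From mathcomp Require Import all_boot all_order all_algebra.
From mathcomp Require Import all_classical all_reals all_analysis.
From mathcomp Require Import ring lra zify.
From mathcomp Require Import measurable_realfun.
Import Order.TTheory GRing.Theory Num.Theory.
Import numFieldNormedType.Exports.
Local Open Scope classical_set_scope.
Local Open Scope ring_scope.
Set Implicit Arguments. Unset Strict Implicit. Unset Printing Implicit Defensive.

(* The covering bound makes Y contain 2n+1 points that are s-separated, with s
   of order (log n)^(-1/gamma), so the balls of radius r = s/2 around them are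
   disjoint and tent functions of height C r^beta supported in them lie in the
   Hölder class. If a ball has design mass at most 1/(2n+1), then with
   probability at least 1/2 no design point falls in it; on that event two
   regression functions that differ only inside the ball generate the same
   data, so no estimator can tell them apart at the centre.
   For (b), any design gives some ball this small a mass, and one compares 0
   with the tent on it. For (a), the design is uniform on the 2n+1 points and
   one averages the two-point bound over all 2^(2n+1) superpositions of tents.
   The smoothness of the noise density only serves to make it measurable. *)

(** * Measurability of sample expectations and the two-point bound *)

Section sample_expect_theory.
Context {R : realType} {d : measure_display} {X : measurableType d}.
Variables (P : probability X R) (f : R -> R).
Hypotheses (f_ge0 : forall x, 0 <= f x) (mf : measurable_fun setT f).
Local Open Scope ereal_scope.

Lemma sample_expect_ge0 (g : X -> R) m (h : m.-tuple (X * R) -> \bar R) :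
  (forall t, 0 <= h t) -> 0 <= sample_expect P g f h.
Proof.
elim: m h => [|m IH] h h0 //=.
apply: integral_ge0 => x _; apply: integral_ge0 => e _.
by apply: mule_ge0; [rewrite lee_fin|exact: IH].
Qed.

(* The parameter space [T] is arbitrary because the induction step absorbs the
   first observation into the parameter. *)
Lemma measurable_sample_expect (g : X -> R) (mg : measurable_fun setT g) m
    d' (T : measurableType d') (h : T * m.-tuple (X * R) -> \bar R) :
  (forall p, 0 <= h p) -> measurable_fun setT h ->
  measurable_fun setT (fun z => sample_expect P g f (fun t => h (z, t))).
Proof.
elim: m d' T h => [|m IH] d' T h h0 mh /=.
  by apply: (measurableT_comp mh); apply: measurable_fun_pair.
pose k (q : T * X * R) := (f q.2)%:E *
  sample_expect P g f
    (fun t : m.-tuple (X * R) => h (q.1.1, [tuple of (q.1.2, (g q.1.2 + q.2)%R) :: t])).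
have k0 q : 0 <= k q.
  by apply: mule_ge0; [rewrite lee_fin|exact: sample_expect_ge0].
have mk : measurable_fun setT k.
  apply: emeasurable_funM.
    by apply/measurable_EFinP; exact: measurableT_comp.
  apply: (IH _ _ (fun p : (T * X * R) * m.-tuple (X * R) => h (p.1.1.1,
    [tuple of (p.1.1.2, (g p.1.1.2 + p.1.2)%R) :: p.2]))) => //.
  apply: (measurableT_comp mh); apply: measurable_fun_pair.
    by do 2! apply: measurableT_comp => //.
  apply: measurable_cons => //; apply: measurable_fun_pair.
    by do 2! apply: measurableT_comp => //.
  apply: measurable_funD; last exact: measurableT_comp.
  by apply: measurableT_comp => //; do 2! apply: measurableT_comp => //.
(* Tonelli is applied twice: the noise is integrated out first, then the design point. *)
have mF := measurable_fun_fubini_tonelli_F (m2 := @lebesgue_measure R) k mk k0.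
apply: (measurable_fun_fubini_tonelli_F (m2 := P) (fubini_F lebesgue_measure k)) => //.
by move=> q; exact: integral_ge0.
Qed.

(** This is the integrand of one recursion step, jointly in design point and noise, as Tonelli
    requires. *)
Lemma measurable_sample_expect_step (g : X -> R) (mg : measurable_fun setT g) m
    (h : m.+1.-tuple (X * R) -> \bar R) :
  (forall p, 0 <= h p) -> measurable_fun setT h ->
  measurable_fun setT (fun q : X * R => (f q.2)%:E * sample_expect P g f
    (fun t : m.-tuple (X * R) => h [tuple of (q.1, (g q.1 + q.2)%R) :: t])).
Proof.
move=> h0 mh; apply: emeasurable_funM.
  by apply/measurable_EFinP; exact: measurableT_comp.
apply: (@measurable_sample_expect g mg m _ _ (fun p : (X * R) * m.-tuple (X * R) =>
  h [tuple of (p.1.1, (g p.1.1 + p.1.2)%R) :: p.2])) => //.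
apply: (measurableT_comp mh); apply: measurable_cons => //.
apply: measurable_fun_pair; first exact: measurableT_comp.
apply: measurable_funD; last exact: measurableT_comp.
by do 2! apply: measurableT_comp => //.
Qed.

(* [1 - p] bounds from below the probability that one observation misses [B];
   as long as all of them do, [g0] and [g1] produce the same data. *)
Lemma two_point_bound (g0 g1 : X -> R) (B : set X) (K p : R) m
    (h0 h1 : m.-tuple (X * R) -> \bar R) :
  \int[@lebesgue_measure R]_e (f e)%:E = 1 ->
  measurable_fun setT g0 -> measurable_fun setT g1 -> measurable B ->
  (forall x, ~ B x -> g0 x = g1 x) -> P B <= p%:E -> (p <= 1)%R -> (0 <= K)%R ->
  (forall t, 0 <= h0 t) -> (forall t, 0 <= h1 t) ->
  measurable_fun setT h0 -> measurable_fun setT h1 ->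
  (forall t, K%:E <= h0 t + h1 t) ->
  (K * (1 - p) ^+ m)%:E <= sample_expect P g0 f h0 + sample_expect P g1 f h1.
Proof.
move=> f1 mg0 mg1 mB gE PB p1 K0.
elim: m h0 h1 => [|m IH] h0 h1 h00 h10 mh0 mh1 hK /=.
  by rewrite expr0 mulr1.
have m0 := measurable_sample_expect_step mg0 h00 mh0.
have m1 := measurable_sample_expect_step mg1 h10 mh1.
set k0 := fun q : X * R => _ in m0.
set k1 := fun q : X * R => _ in m1.
have k00 q : 0 <= k0 q.
  by apply: mule_ge0; [rewrite lee_fin|exact: sample_expect_ge0].
have k10 q : 0 <= k1 q.
  by apply: mule_ge0; [rewrite lee_fin|exact: sample_expect_ge0].
have F0 := measurable_fun_fubini_tonelli_F (m2 := @lebesgue_measure R) k0 m0 k00.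
have F1 := measurable_fun_fubini_tonelli_F (m2 := @lebesgue_measure R) k1 m1 k10.
have Fge0 q (k : X * R -> \bar R) : (forall z, 0 <= k z) ->
    0 <= fubini_F (@lebesgue_measure R) k q.
  by move=> *; exact: integral_ge0.
have c0 : (0 <= K * (1 - p) ^+ m)%R.
  by rewrite mulr_ge0// exprn_ge0// subr_ge0.
set c := (K * (1 - p) ^+ m)%R in c0 *.
rewrite -[X in X + _]/(\int[P]_x fubini_F (@lebesgue_measure R) k0 x).
rewrite -[X in _ + X]/(\int[P]_x fubini_F (@lebesgue_measure R) k1 x).
rewrite -ge0_integralD//; try by move=> *; exact: Fge0.
have mcons (g : X -> R) x e : measurable_fun setT g ->
    measurable_fun setT (fun t : m.-tuple (X * R) => [tuple of (x, (g x + e)%R) :: t]).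
  by move=> ?; exact: measurable_cons.
(* Only first design points outside [B] are kept; they have mass at least [1 - p], which supplies
   the extra factor in the power. *)
apply: (@le_trans _ _ (\int[P]_x (c%:E * (\1_(~` B) x)%:E))).
  rewrite ge0_integralZl//; last first.
    by apply/measurable_EFinP; apply: measurable_indic; exact: measurableC.
  rewrite integral_indic//; last exact: measurableC.
  rewrite setIT [X in _ <= _ * X](probability_setC P mB).
  rewrite exprSr mulrA -/c EFinM lee_wpmul2l ?lee_fin//.
  by rewrite EFinB leeD2l// leeN2.
apply: ge0_le_integral => //.
- by move=> x _; rewrite mule_ge0// lee_fin.
- apply: emeasurable_funM => //.
  by apply/measurable_EFinP; apply: measurable_indic; exact: measurableC.
- exact: emeasurable_funD.
- move=> x _; rewrite indicE; case: (boolP (x \in ~` B)) => xB; last first.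
    by rewrite mule0; apply: adde_ge0; exact: Fge0.
  rewrite in_setC notin_setE in xB.
  have mk0x : measurable_fun setT (fun e => k0 (x, e)).
    exact: (measurableT_comp m0).
  have mk1x : measurable_fun setT (fun e => k1 (x, e)).
    exact: (measurableT_comp m1).
  rewrite mule1 /fubini_F -ge0_integralD//.
  have mfE : measurable_fun setT (fun e => (f e)%:E) by exact/measurable_EFinP.
  (* The constant [c] is written as the integral of [c * f], so that the integrands can be compared
     noise value by noise value. *)
  rewrite -[leLHS]mule1 -f1 -ge0_integralZl//; last by move=> e _; rewrite lee_fin.
  apply: ge0_le_integral => //.
  + by move=> e _; rewrite mule_ge0 ?lee_fin.
  + by apply: emeasurable_funM => //; exact: mfE.
  + exact: emeasurable_funD.
  + move=> e _; rewrite /k0 /k1 /= -ge0_muleDr; try exact: sample_expect_ge0.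
    rewrite muleC; apply: lee_wpmul2l; first by rewrite lee_fin.
    (* Since [x] is outside [B], both models record the same first observation, and the bound [hK]
       passes to the remaining ones. *)
    apply: IH => //.
    * exact: (measurableT_comp mh0 (mcons g0 x e mg0)).
    * exact: (measurableT_comp mh1 (mcons g1 x e mg1)).
    * by move=> t; rewrite -gE.
Qed.

End sample_expect_theory.

(** * Measurability of the metric; separated points from covering numbers *)

Section metric_facts.
Context {R : realType} {d : measure_display} {X : measurableType d}.
Variable rho : X -> X -> R.
Hypotheses (hmetric : is_metric rho) (hborel : borel_space rho).

Lemma measurable_rho_ball (c : X) (r : R) : measurable (rho_ball rho c r).
Proof.
have [_ _ _ tri] := hmetric.
suff : <<s rho_open rho >> (rho_ball rho c r) by rewrite -hborel.
apply: sub_sigma_algebra => x cx.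
exists (r - rho c x); first by rewrite subr_gt0.
by move=> y; rewrite /rho_ball /= ltrBrDl; exact: le_lt_trans.
Qed.

Lemma measurable_rho (c : X) : measurable_fun setT (rho c).
Proof.
apply: (measurability _ (RGenInftyO.measurableE R)).
move=> _ [_ [r ->] <-]; rewrite setTI.
suff -> : rho c @^-1` `]-oo, r[%classic = rho_ball rho c r.
  exact: measurable_rho_ball.
by apply/seteqP; split => y /=; rewrite in_itv.
Qed.

(** Greedy choice: fewer balls than the covering number cannot cover [Y], so some point of [Y] is at
    distance at least [s] from all centres chosen so far. *)
Lemma separated_of_covering_number (Y : set X) (y0 : X) (s : R) (k : nat) :
  Y y0 -> (k <= covering_number rho s Y)%N ->
  exists c : nat -> X, (forall i, Y (c i)) /\
    forall i j, (i < k)%N -> (j < k)%N -> i != j -> s <= rho (c i) (c j).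
Proof.
have [_ _ sym _] := hmetric.
move=> Yy0; elim: k => [_|k IH kN]; first by exists (fun=> y0).
have [c [Yc sep]] := IH (ltnW kN).
have [y Yy farY] : exists2 y, Y y & forall i, (i < k)%N -> s <= rho (c i) y.
  apply: contrapT => nofar; suff : (covering_number rho s Y <= k)%N by rewrite leqNgt kN.
  have cov : Defs.covered_by rho s Y k.
    exists (fun i : 'I_k => c i) => y Yy; apply: contrapT => ncov; apply: nofar.
    exists y => // i ik; rewrite leNgt; apply/negP => ciy; apply: ncov.
    by exists (Ordinal ik).
  (* In the default branch the covering number is 0 and the bound is trivial. *)
  rewrite /covering_number; case: pselect => // ex.
  by case: ex_minnP => m _; apply; exact/asboolP.
exists (fun i => if (i < k)%N then c i else y); split.
  by move=> i; case: ifP.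
move=> i j; rewrite !ltnS; case: ltnP => ik; case: ltnP => jk ik1 jk1 ij.
- exact: sep.
- exact: farY.
- by rewrite sym; exact: farY.
- by case/eqP: ij; apply/eqP; rewrite eqn_leq (leq_trans ik1 jk) (leq_trans jk1 ik).
Qed.

End metric_facts.

(** * Tent functions and their superpositions in the Hölder class *)

Lemma powR_subadd (R : realType) (b x y : R) : 0 < b -> b <= 1 -> 0 <= x -> 0 <= y ->
  (x + y) `^ b <= x `^ b + y `^ b.
Proof.
move=> b0 b1 x0 y0.
have [xy0|xy0] := eqVneq (x + y) 0.
  by rewrite xy0 powR0 ?gt_eqF// addr_ge0// powR_ge0.
have xy : 0 < x + y by rewrite lt_def xy0 addr_ge0.
(* For [b <= 1] a fraction t in [0,1] satisfies t <= t^b. Applied to x/(x+y) and y/(x+y), which add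
   up to 1, this gives the claim. *)
have frac z : 0 <= z -> z <= x + y -> z / (x + y) * (x + y) `^ b <= z `^ b.
  move=> z0 zxy; have [->|zn0] := eqVneq z 0; first by rewrite !mul0r powR_ge0.
  have zp : 0 < z by rewrite lt_def zn0.
  rewrite -[in leRHS](@divfK _ (x + y) xy0 z) powRM; last 2 first.
    by rewrite divr_ge0// ltW.
    exact: ltW.
  rewrite ler_wpM2r ?powR_ge0// ger1_powR//.
  by rewrite divr_gt0//= ler_pdivrMr// mul1r.
rewrite -[leLHS]mul1r -(divff xy0) mulrDl mulrDl.
by rewrite lerD// frac// ?lerDl ?lerDr.
Qed.

Lemma ler_distB_max (R : realDomainType) (a b a' b' e : R) :
  `|a - a'| <= e -> `|b - b'| <= e -> `|Num.max a b - Num.max a' b'| <= e.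
Proof.
rewrite !ler_norml; case: (leP a b); case: (leP a' b');
  move=> ? ? /andP[? ?] /andP[? ?]; lra.
Qed.

Section tents.
Context {R : realType} {d : measure_display} {X : measurableType d}.
Variable rho : X -> X -> R.
Hypotheses (hmetric : is_metric rho) (hborel : borel_space rho).
Variables (Y : set X) (beta C : R).
Hypotheses (hC : 0 < C) (hbeta0 : 0 < beta) (hbeta1 : beta <= 1).

(** Taking the difference of the powers makes the Hölder constant exactly [C], by subadditivity of
    the power. *)
Definition tent (r : R) (c : X) (y : X) : R :=
  Num.max 0 (C * (r `^ beta - rho c y `^ beta)).

Lemma tent_ge0 r c y : 0 <= tent r c y.
Proof. by rewrite /tent le_max lexx. Qed.

Lemma tent_center r c : tent r c c = C * r `^ beta.
Proof.
have [_ eq0 _ _] := hmetric.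
rewrite /tent (proj2 (eq0 c c) erefl) powR0 ?gt_eqF// subr0.
by apply/max_r/mulr_ge0; [exact: ltW|exact: powR_ge0].
Qed.

Lemma tent_out r c y : 0 <= r -> ~ rho_ball rho c r y -> tent r c y = 0.
Proof.
have [rge0 _ _ _] := hmetric.
move=> r0 /negP; rewrite -leNgt => cy; apply: max_l.
by rewrite pmulr_rle0// subr_le0 ge0_ler_powR// ?nnegrE// ltW.
Qed.

Lemma holder_class0 : holder_class rho Y beta C (fun=> 0).
Proof.
split => //.
- by move=> y _; rewrite normr0 ltW.
- by move=> y z _ _; rewrite subrr normr0 mulr_ge0 ?powR_ge0// ltW.
Qed.

Lemma holder_class_max g h : holder_class rho Y beta C g ->
  holder_class rho Y beta C h -> holder_class rho Y beta C (fun y => Num.max (g y) (h y)).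
Proof.
move=> [mg bg hg] [mh bh hh]; split.
- exact: measurable_maxr.
(* The bound by [C] is a distance to 0 = max(0,0), so the estimate for distances of maxima covers it
   too. *)
- move=> y Yy; rewrite -[X in `|X|]subr0 -(maxxx 0); apply: ler_distB_max;
  by rewrite subr0; auto.
- by move=> y z Yy Yz; apply: ler_distB_max; auto.
Qed.

(** The condition [r <= 1] keeps the height below [C]; the Hölder bound combines the triangle
    inequality with subadditivity of the power. *)
Lemma holder_class_tent r c : 0 <= r <= 1 -> holder_class rho Y beta C (tent r c).
Proof.
have [rge0 _ sym tri] := hmetric.
move=> /andP[r0 r1].
have rb1 : r `^ beta <= 1.
  have <- : 1 `^ beta = 1 :> R by rewrite powR1.
  by rewrite ge0_ler_powR ?nnegrE// ltW.
have dpow y z : rho c y `^ beta <= rho c z `^ beta + rho y z `^ beta.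
  apply: (le_trans _ (powR_subadd _ _ _ _)) => //.
  rewrite ge0_ler_powR ?nnegrE ?addr_ge0//; first exact: ltW.
  by rewrite (sym y z).
split.
- apply: measurable_maxr => //; apply: measurable_funM => //.
  apply: measurable_funB => //.
  exact: (measurableT_comp (measurable_powR beta) (measurable_rho hmetric hborel c)).
- move=> y _; rewrite ger0_norm ?tent_ge0// /tent ge_max ltW//=.
  rewrite -[leRHS]mulr1 ler_pM2l// lerBlDr (le_trans rb1)// lerDl powR_ge0//.
- move=> y z _ _; apply: ler_distB_max.
    by rewrite subrr normr0 mulr_ge0 ?powR_ge0// ltW.
  rewrite -mulrBr normrM gtr0_norm// ler_pM2l//.
  have := dpow y z; have := dpow z y; rewrite (sym z y) => ? ?.
  by rewrite ler_norml; lra.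
Qed.

(** For disjoint supports this maximum equals the sum of the selected tents, but a maximum preserves
    the Hölder constant without any argument on the supports. *)
Definition tents m (r : R) (c : nat -> X) (th : {ffun 'I_m -> bool}) (y : X) : R :=
  \big[Num.max/0]_(k < m) (if th k then tent r (c k) y else 0).

Lemma holder_class_tents m r c (th : {ffun 'I_m -> bool}) : 0 <= r <= 1 ->
  holder_class rho Y beta C (tents r c th).
Proof.
move=> r01.
(* As an iterated operation on functions, the maximum is accessible to induction with
   [holder_class_max]. *)
have -> : tents r c th = \big[(fun g h y => Num.max (g y) (h y))/(fun=> 0)]_(k < m)
    (fun y => if th k then tent r (c k) y else 0).
  apply/funext => y; rewrite /tents.
  by elim/big_rec2 : _ => // k _ g _ <-.
elim/big_ind : _ => [|g h|k _]; first exact: holder_class0.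
  exact: holder_class_max.
by case: (th k); [exact: holder_class_tent|exact: holder_class0].
Qed.

(** Each centre lies outside the open balls of the other tents, so only its own tent contributes
    there. *)
Lemma tents_center m r c (th : {ffun 'I_m -> bool}) (k : 'I_m) : 0 <= r ->
  (forall i j, (i < m)%N -> (j < m)%N -> i != j -> r <= rho (c i) (c j)) ->
  tents r c th (c k) = if th k then C * r `^ beta else 0.
Proof.
move=> r0 sep; rewrite -(tent_center r (c k)).
set v := RHS; have v0 : 0 <= v by rewrite /v; case: ifP; rewrite ?tent_ge0.
apply/eqP; rewrite eq_le; apply/andP; split.
  apply/bigmax_leP; split => // i _; case: ifP => // thi.
  have [ik|ik] := eqVneq i k; first by rewrite /v -ik thi.
  rewrite tent_out//; apply/negP; rewrite -leNgt sep//.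
exact: (le_bigmax _ (fun i : 'I_m => if th i then tent r (c i) (c k) else 0) k).
Qed.

Lemma tents_out m (r : R) (c : nat -> X) (th th' : {ffun 'I_m -> bool}) (k : 'I_m) y : 0 <= r ->
  (forall i, i != k -> th i = th' i) -> ~ rho_ball rho (c k) r y ->
  tents r c th y = tents r c th' y.
Proof.
move=> r0 thE ky; apply: eq_bigr => i _.
have [->|ik] := eqVneq i k; last by rewrite thE.
by rewrite tent_out// !if_same.
Qed.

End tents.

(** * The probability that all observations miss a ball *)

Lemma bernoulli_ineq (R : realDomainType) (p : R) m : 0 <= p <= 1 ->
  1 - p *+ m <= (1 - p) ^+ m.
Proof.
move=> /andP[p0 p1]; elim: m => [|m IH]; first by rewrite mulr0n subr0 expr0.
rewrite exprS (le_trans _ (ler_wpM2l _ IH)) ?subr_ge0//.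
have : 0 <= p * (p *+ m) by rewrite mulr_ge0// mulrn_wge0.
rewrite mulrS; lra.
Qed.

(** By Bernoulli the power is at least 1 - n/(2n+1) >= 1/2; this is why 2n+1 points are used. *)
Lemma half_le_expr_invn (R : realFieldType) n : 2^-1 <= (1 - n.*2.+1%:R^-1) ^+ n :> R.
Proof.
apply: le_trans (bernoulli_ineq _ _); last first.
  by rewrite invr_ge0 ler0n invf_le1 ?ltr0n// ler1n.
have : n.*2.+1%:R^-1 *+ n <= 2^-1 :> R.
  have -> : n.*2.+1%:R = 2 * n%:R + 1 :> R by rewrite -natr1 -mul2n natrM.
  have n0 : 0 <= n%:R :> R by [].
  by rewrite -[leLHS]mulr_natl ler_pdivrMr; lra.
by move: (_ *+ n) => q; lra.
Qed.

(** * The uniform design on finitely many points *)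

Section uniform_points.
Context {R : realType} {d : measure_display} {X : measurableType d}.
Variables (m : nat) (c : nat -> X).

(** The points are [c 0], ..., [c m], counted with multiplicity; indexing by [m.+1] keeps the
    normalisation positive. *)
Definition uniform_points : set X -> \bar R :=
  mscale ((m.+1%:R : R)^-1)%:nng (msum (fun k => \d_(c k)) m.+1).

HB.instance Definition _ := Measure.on uniform_points.

Lemma uniform_pointsE A :
  uniform_points A = ((m.+1%:R^-1)%:E * \sum_(k < m.+1) \d_(c k) A)%E.
Proof. by []. Qed.

Lemma uniform_points_all A : (forall k, A (c k)) -> uniform_points A = 1%E.
Proof.
move=> Ac; rewrite uniform_pointsE.
rewrite (eq_bigr (fun=> 1%E)) => [|k _]; last by rewrite diracE mem_set.
rewrite sumEFin sumr_const card_ord -EFinM.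
by rewrite mulVf ?pnatr_eq0.
Qed.

Lemma uniform_points_single A (k : 'I_m.+1) :
  (forall i : 'I_m.+1, i != k -> ~ A (c i)) ->
  (uniform_points A <= (m.+1%:R^-1)%:E)%E.
Proof.
move=> nA; rewrite uniform_pointsE -[leRHS]mule1.
rewrite lee_wpmul2l ?lee_fin ?invr_ge0//.
rewrite (bigD1 k)//= big1 ?adde0 => [|i /nA nAi]; last by rewrite diracE memNset.
by rewrite diracE lee_fin; case: (_ \in _).
Qed.

HB.instance Definition _ := Measure_isProbability.Build _ _ _ uniform_points
  (uniform_points_all (fun k => I)).

Lemma ge0_integral_uniform_points (h : X -> \bar R) :
  (forall x, 0 <= h x)%E -> measurable_fun setT h ->
  (\int[uniform_points]_x h x = (m.+1%:R^-1)%:E * \sum_(k < m.+1) h (c k))%E.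
Proof.
move=> h0 mh; rewrite ge0_integral_mscale// ge0_integral_measure_sum//.
congr (_ * _)%E; apply: eq_bigr => k _.
by rewrite integral_dirac// diracT mul1e.
Qed.

End uniform_points.

(** * Averaging over the hypercube of sign patterns *)

Definition flip m (k : 'I_m) (th : {ffun 'I_m -> bool}) : {ffun 'I_m -> bool} :=
  [ffun i => (i == k) (+) th i].

Lemma flipK m (k : 'I_m) : involutive (flip k).
Proof. by move=> th; apply/ffunP => i; rewrite !ffunE addbA addbb. Qed.

(** Assouad's argument: twice the sum of [r th k] over all [th] and [k] is at least [a * m * N] by
    pairing each [th] with its flip, and at most [2 * b * N] by the row bounds. *)
Lemma assouad_average (R : realType) m (r : {ffun 'I_m -> bool} -> 'I_m -> \bar R)
    (a b : R) :
  (forall th k, (a%:E <= r th k + r (flip k th) k)%E) ->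
  (forall th, (\sum_(k < m) r th k <= b%:E)%E) ->
  a *+ m <= b *+ 2.
Proof.
move=> ra rb.
have card0 : (0 < #|{ffun 'I_m -> bool}|)%N.
  by apply/card_gt0P; exists [ffun=> true].
set N := #|{ffun 'I_m -> bool}| in card0 *.
have S2b : ((\sum_(th : {ffun 'I_m -> bool}) \sum_(k < m) r th k) +
    (\sum_(th : {ffun 'I_m -> bool}) \sum_(k < m) r th k) <= (b *+ 2 *+ N)%:E)%E.
  rewrite mulrnAC mulr2n EFinD; apply: leeD;
  by rewrite -sumr_const -sumEFin; apply: lee_sum.
have aS : ((a *+ m *+ N)%:E <= (\sum_(th : {ffun 'I_m -> bool}) \sum_(k < m) r th k) +
    (\sum_(th : {ffun 'I_m -> bool}) \sum_(k < m) r th k))%E.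
  rewrite exchange_big/= -big_split/= mulrnAC.
  rewrite -[X in _ *+ X](card_ord m) -[(_ *+ _)%R]sumr_const -sumEFin.
  apply: lee_sum => k _.
  (* For fixed [k], [flip k] permutes the patterns, so the second copy of the sum may run over
     flipped patterns. *)
  rewrite [X in (_ <= _ + X)%E](reindex_inj (inv_inj (flipK k)))/= -big_split/=.
  by rewrite -sumr_const -sumEFin; apply: lee_sum.
have := le_trans aS S2b; rewrite lee_fin.
by rewrite ler_pMn2r.
Qed.

(** * The separation scale and the logarithmic rate *)

Section scale.
Context {R : realType}.
Variables (cx gamma : R).
Hypotheses (hcx : 0 < cx) (hgamma : 0 < gamma).

(* The separation at which the covering bound is [n ^ 2]. *)
Definition scale (n : nat) : R := (2 / cx * ln n%:R) `^ (- gamma^-1).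

Lemma near_ln_gt (t : R) : \forall n \near \oo, t < ln n%:R.
Proof.
near=> n; have tn : expR t < n%:R.
  by near: n; exact: nbhs_infty_gtr.
by rewrite -(expRK t) ltr_ln ?posrE ?expR_gt0// (lt_trans _ tn) ?expR_gt0.
Unshelve. all: by end_near. Qed.

Lemma near_scale_lt (t : R) : 0 < t -> \forall n \near \oo, 0 < scale n < t.
Proof.
move=> t0; near=> n.
have lnn0 : 0 < ln n%:R :> R by near: n; exact: near_ln_gt.
(* At this value of [ln n] the scale would equal [t]; beyond it, it is smaller. *)
have lnt : cx / 2 * t `^ (- gamma) < ln n%:R by near: n; exact: near_ln_gt.
have A0 : 0 < 2 / cx * ln n%:R by rewrite mulr_gt0// divr_gt0.
rewrite powR_gt0//= ltNge; apply/negP => ts.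
suff : 2 / cx * ln n%:R <= t `^ (- gamma).
  apply/negP; rewrite -ltNge.
  move: lnt; rewrite [X in X < _]mulrAC ltr_pdivrMr// => lnt.
  by rewrite [X in _ < X]mulrAC ltr_pdivlMr// mulrC [X in _ < X]mulrC.
have : t `^ gamma <= scale n `^ gamma by rewrite ge0_ler_powR ?nnegrE ?powR_ge0// ltW.
rewrite /scale -powRrM mulNr mulVf ?gt_eqF// powR_inv1 ?(ltW A0)// powRN => h.
by rewrite -[leLHS]invrK lef_pV2// posrE ?powR_gt0// invr_gt0.
Unshelve. all: by end_near. Qed.

Lemma scale_powRN n : 0 <= ln n%:R :> R -> scale n `^ (- gamma) = 2 / cx * ln n%:R.
Proof.
move=> l0; rewrite /scale -powRrM mulrNN mulVf ?gt_eqF// powRr1//.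
by rewrite mulr_ge0// divr_ge0// ltW.
Qed.

(** The squared height of a tent of radius [scale n / 2] is a constant times the rate of the
    theorem. *)
Lemma scale_rate (C beta : R) n : 0 <= ln n%:R :> R ->
  (C * (scale n / 2) `^ beta) ^+ 2 =
  (C * 2^-1 `^ beta) ^+ 2 * (2 / cx) `^ (- (2 * beta / gamma)) *
    ln n%:R `^ (- (2 * beta / gamma)).
Proof.
move=> l0; have a0 : 0 <= 2 / cx by rewrite divr_ge0// ltW.
have E : (scale n `^ beta) ^+ 2 =
    (2 / cx) `^ (- (2 * beta / gamma)) * ln n%:R `^ (- (2 * beta / gamma)).
  rewrite -powRM// -[LHS]powR_mulrn ?powR_ge0// /scale -!powRrM.
  by congr (_ `^ _); field; rewrite gt_eqF.
rewrite powRM ?powR_ge0 ?invr_ge0// -[RHS]mulrA -E; ring.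
Qed.

(** At this scale the covering bound reads 2 ln n <= ln N, so N >= n^2, which is at least 2n+1 once
    n >= 3. *)
Lemma near_scale_covering {d : measure_display} {X : measurableType d}
    (rho : X -> X -> R) (Y : set X) (s0 : R) : 0 < s0 ->
  (forall s : R, 0 < s < s0 ->
     cx * s `^ (- gamma) <= ln (covering_number rho s Y)%:R) ->
  \forall n \near \oo, (n.*2.+1 <= covering_number rho (scale n) Y)%N.
Proof.
move=> s00 hcov; near=> n.
have lnn0 : 0 < ln n%:R :> R by near: n; exact: near_ln_gt.
have n3 : (3 <= n)%N by near: n; exact: nbhs_infty_ge.
have sn : 0 < scale n < s0 by near: n; exact: near_scale_lt.
have := hcov _ sn; rewrite scale_powRN ?(ltW lnn0)// mulrA mulrCA divff ?gt_eqF// mulr1 => lnN.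
have n0 : 0 < n%:R :> R by rewrite ltr0n (leq_trans _ n3).
(* If the covering number were 0, its logarithm would take the default value 0, against 2 ln n >
   0. *)
have N0 : (0 < covering_number rho (scale n) Y)%N.
  rewrite lt0n; apply/negP => /eqP N0; move: lnN; by rewrite N0 (ln0 (lexx 0)) leNgt mulr_gt0.
have : (n ^ 2 <= covering_number rho (scale n) Y)%N.
  rewrite -(ler_nat R) -ler_ln ?posrE ?ltr0n ?expn_gt0 ?(leq_trans _ n3)//.
  by rewrite natrX lnXn// -[leLHS]mulr_natl.
by apply: leq_trans; rewrite expnS expn1 -muln2; nia.
Unshelve. all: by end_near. Qed.

End scale.

(** * Two-point lower bounds for the squared error and for its tail *)

Lemma le_sqr_dist2 (R : realFieldType) (a b u : R) :
  (a - b) ^+ 2 / 2 <= (u - a) ^+ 2 + (u - b) ^+ 2.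
Proof.
have : 0 <= (u - a + (u - b)) ^+ 2 by exact: sqr_ge0.
by rewrite !expr2; lra.
Qed.

Section two_point_risk.
Context {R : realType} {d : measure_display} {X : measurableType d}.
Variables (P : probability X R) (f : R -> R).
Hypotheses (f_ge0 : forall x, 0 <= f x) (mf : measurable_fun setT f).
Hypothesis f_int : (\int[@lebesgue_measure R]_x (f x)%:E = 1)%E.
Variables (n : nat) (ghat : X -> n.-tuple (X * R) -> R).
Hypothesis mghat : measurable_fun setT (fun p : X * n.-tuple (X * R) => ghat p.1 p.2).
Variables (g0 g1 : X -> R) (B : set X).
Hypotheses (mg0 : measurable_fun setT g0) (mg1 : measurable_fun setT g1).
Hypotheses (mB : measurable B) (gE : forall x, ~ B x -> g0 x = g1 x).
Hypothesis PB : (P B <= (n.*2.+1%:R^-1)%:E)%E.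

Lemma two_point_half (K : R) (h0 h1 : n.-tuple (X * R) -> \bar R) : 0 <= K ->
  (forall t, 0 <= h0 t)%E -> (forall t, 0 <= h1 t)%E ->
  measurable_fun setT h0 -> measurable_fun setT h1 ->
  (forall t, K%:E <= h0 t + h1 t)%E ->
  ((K / 2)%:E <= sample_expect P g0 f h0 + sample_expect P g1 f h1)%E.
Proof.
move=> K0 h00 h10 mh0 mh1 hK.
apply: le_trans (two_point_bound f_ge0 mf f_int mg0 mg1 mB gE PB _ K0 h00 h10 mh0 mh1 hK).
  by rewrite lee_fin ler_wpM2l// half_le_expr_invn.
by rewrite invf_le1 ?ltr0n// ler1n.
Qed.

Lemma measurable_loss (x : X) (a : R) :
  measurable_fun setT (fun t : n.-tuple (X * R) => (ghat x t - a) ^+ 2).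
Proof.
apply: measurable_funX; apply: measurable_funB => //.
exact: (measurableT_comp mghat (measurable_pair1 x)).
Qed.

Lemma two_point_square (x : X) :
  (((g0 x - g1 x) ^+ 2 / 4)%:E <=
   sample_expect P g0 f (fun t => ((ghat x t - g0 x) ^+ 2)%:E) +
   sample_expect P g1 f (fun t => ((ghat x t - g1 x) ^+ 2)%:E))%E.
Proof.
have -> : (g0 x - g1 x) ^+ 2 / 4 = (g0 x - g1 x) ^+ 2 / 2 / 2 by field.
apply: two_point_half.
- by rewrite divr_ge0 ?sqr_ge0.
- by move=> t; rewrite lee_fin sqr_ge0.
- by move=> t; rewrite lee_fin sqr_ge0.
- by apply/measurable_EFinP; exact: measurable_loss.
- by apply/measurable_EFinP; exact: measurable_loss.
- by move=> t; rewrite -EFinD lee_fin le_sqr_dist2.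
Qed.

(** An estimate within squared error [tau] of both values would force (g0 x - g1 x)^2 <= 4 tau. So
    at least one indicator is 1 and [two_point_half] applies with [K] = 1. *)
Lemma two_point_test (x : X) (tau : R) : 4 * tau < (g0 x - g1 x) ^+ 2 ->
  ((2^-1 : R)%:E <=
   sample_expect P g0 f (fun t => ((tau < (ghat x t - g0 x) ^+ 2)%R%:R : R)%:E) +
   sample_expect P g1 f (fun t => ((tau < (ghat x t - g1 x) ^+ 2)%R%:R : R)%:E))%E.
Proof.
move=> tau_lt; rewrite -[2^-1]mul1r.
have mtest a : measurable_fun setT
    (fun t : n.-tuple (X * R) => ((tau < (ghat x t - a) ^+ 2)%R%:R : R)%:E).
  apply/measurable_EFinP.
  have -> : (fun t : n.-tuple (X * R) => ((tau < (ghat x t - a) ^+ 2)%R%:R : R)) =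
      \1_((fun t : n.-tuple (X * R) => (ghat x t - a) ^+ 2) @^-1` `]tau, +oo[%classic).
    apply/funext => t; rewrite indicE; congr (nat_of_bool _)%:R.
    by apply/idP/idP => [lt|/set_mem/=]; [apply/mem_set|]; rewrite /= in_itv/= andbT.
  apply: measurable_indic; rewrite -[X in measurable X]setTI.
  by apply: measurable_loss => //; exact: measurable_itv.
apply: two_point_half => //.
move=> t; rewrite -EFinD lee_fin -natrD ler1n addn_gt0 !lt0b.
have [//|/= le0] := ltP tau ((ghat x t - g0 x) ^+ 2).
rewrite ltNge; apply/negP => le1.
have := le_sqr_dist2 (g0 x) (g1 x) (ghat x t); lra.
Qed.

End two_point_risk.

(** * Limit inferior, pigeonhole for measures, the empty set *)

Lemma limn_einf_ge (R : realType) (u : (\bar R)^nat) (a : \bar R) :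
  (\forall n \near \oo, a <= u n)%E -> (a <= limn_einf u)%E.
Proof.
move=> [N _ aN]; rewrite limn_einf_lim; apply: lime_ge; first exact: is_cvg_einfs.
exists N => // n /= Nn; apply: le_ereal_inf_tmp => _ [k /= nk <-].
by apply: aN; exact: leq_trans nk.
Qed.

Lemma exists_small_of_disjoint (R : realType) d (X : measurableType d)
    (P : probability X R) m (F : 'I_m.+1 -> set X) :
  (forall k, measurable (F k)) -> trivIset setT F ->
  exists k, (P (F k) <= (m.+1%:R^-1)%:E)%E.
Proof.
move=> mF tF; apply: contrapT => /forallNP big.
have Pfin k : P (F k) = (fine (P (F k)))%:E by rewrite fineK// fin_num_measure.
have gt k : m.+1%:R^-1 < fine (P (F k)).
  by rewrite ltNge -lee_fin -Pfin; apply/negP/big.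
have : (\sum_(k < m.+1) P (F k) <= 1)%E.
  rewrite -(measure_bigsetU_ord P xpredT)//; apply: probability_le1.
  exact: bigsetU_measurable.
rewrite (eq_bigr _ (fun k _ => Pfin k)) sumEFin lee_fin leNgt => /negP; apply.
(* If every set had mass above 1/(m+1), the total would exceed 1. *)
have {1}-> : 1 = \sum_(k < m.+1) m.+1%:R^-1 :> R.
  by rewrite sumr_const card_ord -[RHS]mulr_natl mulfV ?pnatr_eq0.
apply: ltr_sum => [|k _]; last exact: gt.
by apply/hasP; exists ord0 => //; rewrite mem_index_enum.
Qed.

Lemma covering_number_set0 (R : realType) d (X : measurableType d) (rho : X -> X -> R) s :
  covering_number rho s set0 = 0%N.
Proof.
rewrite /covering_number; case: pselect => // ex.
case: ex_minnP => m _ /(_ 0%N); rewrite leqn0 => h; apply/eqP/h/asboolP.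
by exists (fun i : 'I_0 => False_rect X (notF (ltn_ord i))) => x [].
Qed.

(** * Minimax lower bounds for a fixed sample size *)

Section lower_bounds.
Context {R : realType} {d : measure_display} {X : measurableType d}.
Variable rho : X -> X -> R.
Hypotheses (hmetric : is_metric rho) (hborel : borel_space rho).
Variables (Y : set X) (beta C : R).
Hypotheses (hC : 0 < C) (hbeta0 : 0 < beta) (hbeta1 : beta <= 1).
Variable f : R -> R.
Hypotheses (f_ge0 : forall x, 0 <= f x) (mf : measurable_fun setT f).
Hypothesis f_int : (\int[@lebesgue_measure R]_x (f x)%:E = 1)%E.
Variables (n : nat) (c : nat -> X) (s : R).
Hypotheses (Yc : forall k, Y (c k)) (s01 : 0 < s < 1).
Hypothesis sep : forall i j, (i < n.*2.+1)%N -> (j < n.*2.+1)%N -> i != j ->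
  s <= rho (c i) (c j).
Variable ghat : X -> n.-tuple (X * R) -> R.
Hypothesis mghat : measurable_fun setT (fun p : X * n.-tuple (X * R) => ghat p.1 p.2).

Let r := s / 2.
Let r01 : 0 <= r <= 1.
Proof. by rewrite /r; case/andP: s01 => ? ?; lra. Qed.
Let r0 : 0 <= r. Proof. by case/andP: r01. Qed.
Let rs : r <= s. Proof. by rewrite /r; case/andP: s01 => ? ?; lra. Qed.

Lemma minimax_test_bound (P : probability X R) (tau : R) :
  4 * tau < (C * r `^ beta) ^+ 2 ->
  (((4^-1 : R)%:E <= ereal_sup [set sample_expect P gx.1 f
     (fun t => ((tau < (ghat gx.2 t - gx.1 gx.2) ^+ 2)%R%:R : R)%:E)
     | gx in holder_class rho Y beta C `*` Y])%E).
Proof.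
have [_ _ sym tri] := hmetric.
move=> tau_lt.
have [k Pk] : exists k : 'I_n.*2.+1,
    (P (rho_ball rho (c k) r) <= (n.*2.+1%:R^-1)%:E)%E.
  (* A common point of two balls of radius s/2 would bring their centres closer than [s]. *)
  apply: exists_small_of_disjoint => [k|]; first exact: measurable_rho_ball.
  move=> i j _ _ [z []]; rewrite /rho_ball/= => iz jz.
  apply/eqP; apply: contraT => ij.
  have := sep (ltn_ord i) (ltn_ord j) ij; rewrite leNgt => /negP; case.
  by rewrite (le_lt_trans (tri _ z _))// (sym z) /r (splitr s) ltrD.
have tentH := holder_class_tent hmetric hborel Y hC hbeta0 hbeta1 (c k) r01.
have zeroH := holder_class0 rho Y beta hC.
have [mtent _ _] := tentH; have [mzero _ _] := zeroH.
have gE x : ~ rho_ball rho (c k) r x -> (fun=> 0) x = tent rho beta C r (c k) x.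
  by move=> xB; rewrite (tent_out _ hC).
have := @two_point_test _ _ _ P f f_ge0 mf f_int n ghat mghat (fun=> 0)
  (tent rho beta C r (c k)) (rho_ball rho (c k) r) mzero mtent
  (measurable_rho_ball hmetric hborel _ _) gE Pk (c k) tau.
rewrite tent_center// sub0r sqrrN => /(_ tau_lt) H.
set S := ereal_sup _.
have leS g x : holder_class rho Y beta C g -> Y x -> (sample_expect P g f
    (fun t => ((tau < (ghat x t - g x) ^+ 2)%R%:R : R)%:E) <= S)%E.
  by move=> gH Yx; apply: ereal_sup_ubound; exists (g, x).
have H0 := leS _ _ zeroH (Yc k).
have := leS _ _ tentH (Yc k); rewrite tent_center// => H1.
(* Both error probabilities are at most [S], so S >= 1/4. *)
have {H} : ((2^-1 : R)%:E <= S + S)%E by exact: le_trans (leeD H0 H1).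
case: S {leS H0 H1} => [u| |]//=.
- by rewrite -EFinD !lee_fin; lra.
- by move=> _; rewrite leey.
Qed.

Lemma minimax_square_bound (b : R) :
  (ereal_sup [set \int[uniform_points n.*2 c]_x
     sample_expect (uniform_points n.*2 c : probability X R) g f
       (fun t => ((ghat x t - g x) ^+ 2)%:E) | g in holder_class rho Y beta C] <= b%:E)%E ->
  (C * r `^ beta) ^+ 2 <= 8 * b.
Proof.
move=> supb; pose P : probability X R := uniform_points n.*2 c.
pose g th := tents rho beta C r c (m := n.*2.+1) th.
have gH th : holder_class rho Y beta C (g th) by exact: holder_class_tents.
have mg th : measurable_fun setT (g th) by have [] := gH th.
pose loss th x := sample_expect P (g th) f (fun t => ((ghat x t - g th x) ^+ 2)%:E).
have loss0 th x : (0 <= loss th x)%E.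
  by apply: sample_expect_ge0 => // t; rewrite lee_fin sqr_ge0.
have mloss th : measurable_fun setT (loss th).
  apply: (@measurable_sample_expect _ _ _ P f f_ge0 mf _ (mg th) n _ _
    (fun p : X * n.-tuple (X * R) => ((ghat p.1 p.2 - g th p.1) ^+ 2)%:E)).
    by move=> p; rewrite lee_fin sqr_ge0.
  apply/measurable_EFinP; apply: measurable_funX; apply: measurable_funB => //.
  exact: measurableT_comp.
have m0 : 0 < n.*2.+1%:R :> R by rewrite ltr0n.
(* Under the uniform design the integrated risk is the average of the losses at the centres. *)
have risk th : (\sum_(k < n.*2.+1) loss th (c k) <= (n.*2.+1%:R * b)%:E)%E.
  rewrite EFinM -lee_pdivrMl// -ge0_integral_uniform_points//.
  by apply: le_trans supb; apply: ereal_sup_ubound; exists (g th).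
have sepr i j : (i < n.*2.+1)%N -> (j < n.*2.+1)%N -> i != j -> r <= rho (c i) (c j).
  by move=> im jm ij; exact: le_trans (sep im jm ij).
have pair th (k : 'I_n.*2.+1) : (((C * r `^ beta) ^+ 2 / 4)%:E <=
    loss th (c k) + loss (flip k th) (c k))%E.
  have -> : (C * r `^ beta) ^+ 2 = (g th (c k) - g (flip k th) (c k)) ^+ 2.
    rewrite /g !tents_center// ffunE eqxx /=.
    by case: (th k); rewrite ?sub0r ?subr0 ?sqrrN.
  apply: (two_point_square f_ge0 mf f_int mghat (mg th) (mg _)
    (measurable_rho_ball hmetric hborel (c k) r)).
    move=> x; apply: tents_out => // i ik.
    by rewrite ffunE (negbTE ik).
  (* The ball around [c k] contains no other centre, so its mass is at most 1/(2n+1). *)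
  apply: (uniform_points_single (k := k)) => i ik; apply/negP; rewrite -leNgt.
  by apply: sepr; rewrite // eq_sym.
(* With h the tent height and m = 2n+1, this gives m h^2/4 <= 2 m b, that is h^2 <= 8 b. *)
have := assouad_average (r := fun th k => loss th (c k)) pair risk.
rewrite -(mulr_natl (_ / 4)) -mulrnAr ler_pM2l// mulr2n; lra.
Qed.

End lower_bounds.

(** * Both lower bounds at the logarithmic rate *)

Theorem theorem2 (R : realType) (d : measure_display) (X : measurableType d)
  (rho : X -> X -> R)
  (hmetric : is_metric rho) (hpolish : polish rho) (hborel : borel_space rho)
  (hne : inhabited X)
  (Y : set X) (hYmeas : measurable Y) (hYcpt : rho_compact rho Y)
  (s0 cx0 cx1 gamma : R) (hs0 : 0 < s0) (hcx0 : 0 < cx0) (hcx01 : cx0 < cx1)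
  (hgamma : 0 < gamma)
  (hcov : forall s : R, 0 < s < s0 ->
     cx0 * s `^ (- gamma) <= ln (covering_number rho s Y)%:R
     /\ ln (covering_number rho s Y)%:R <= cx1 * s `^ (- gamma))
  (C beta : R) (hC : 0 < C) (hbeta0 : 0 < beta) (hbeta1 : beta <= 1)
  (f : R -> R)
  (hf_ge0 : forall x, 0 <= f x)
  (hf_int : (\int[@lebesgue_measure R]_x (f x)%:E = 1)%E)
  (hf_der : forall x, derivable f x 1)
  (hf_cont : continuous (derive1 f))
  (hf_fisher : (\int[@lebesgue_measure R]_x ((derive1 f x) ^+ 2 / f x)%:E < +oo)%E) :
  (* (a) *)
  (exists P : nat -> probability X R, (forall n, P n Y = 1%E) /\
    forall ghat : forall n : nat, X -> n.-tuple (X * R) -> R,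
      (forall n, measurable_fun setT
                   (fun p : X * n.-tuple (X * R) => ghat n p.1 p.2)) ->
      ~ (forall eps : R, 0 < eps ->
           \forall n \near \oo,
             (ereal_sup [set (\int[P n]_x
                  sample_expect (P n) g f
                    (fun t : n.-tuple (X * R) => ((ghat n x t - g x) ^+ 2)%:E))%E
                | g in holder_class rho Y beta C]
              <= (eps * ln n%:R `^ (- (2 * beta / gamma)))%:E)%E))
  /\
  (* (b) *)
  (exists c : R, 0 < c /\
    forall P : nat -> probability X R, (forall n, P n Y = 1%E) ->
    forall ghat : forall n : nat, X -> n.-tuple (X * R) -> R,
      (forall n, measurable_fun setT
                   (fun p : X * n.-tuple (X * R) => ghat n p.1 p.2)) ->
      (0 < limn_einf (fun n : nat =>
          ereal_sup [set sample_expect (P n) gx.1 f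
                       (fun t : n.-tuple (X * R) =>
                          ((c * ln n%:R `^ (- (2 * beta / gamma))
                              < (ghat n gx.2 t - gx.1 gx.2) ^+ 2)%R%:R : R)%:E)
                    | gx in holder_class rho Y beta C `*` Y]))%E).
Proof.
have mf : measurable_fun setT f.
  apply: continuous_measurable_fun => x; apply: differentiable_continuous.
  exact/derivable1_diffP.
(* For empty [Y] the covering number is 0 and [ln 0] is 0, against the positive lower bound. *)
have [y0 Yy0] : exists y, Y y.
  apply: contrapT => /forallNP Y0.
  have /andP[+ _] : (0 < s0 / 2 < s0) && true by rewrite divr_gt0//=; lra.
  move=> /hcov[+ _].
  have -> : Y = set0 by apply/seteqP; split => y //= /Y0.
  by rewrite covering_number_set0 (ln0 (lexx 0)) leNgt mulr_gt0 ?powR_gt0 ?divr_gt0.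
have hcov0 s : 0 < s < s0 -> cx0 * s `^ (- gamma) <= ln (covering_number rho s Y)%:R.
  by move=> /hcov[].
(* For [n] with too small a covering number the constant sequence [y0] is a placeholder, so that a
   design exists for every [n]. *)
have packing n : exists c : nat -> X, (forall i, Y (c i)) /\
    ((n.*2.+1 <= covering_number rho (scale cx0 gamma n) Y)%N ->
     forall i j, (i < n.*2.+1)%N -> (j < n.*2.+1)%N -> i != j ->
       scale cx0 gamma n <= rho (c i) (c j)).
  have [big|small] := leqP n.*2.+1 (covering_number rho (scale cx0 gamma n) Y).
    by have [c [Yc sep]] := separated_of_covering_number hmetric Yy0 big; exists c.
  by exists (fun=> y0).
have [c hc] := choice packing.
have Yc n k : Y (c n k) by have [] := hc n.
have nlarge : \forall n \near \oo, [/\ 0 < scale cx0 gamma n < 1, 0 < ln n%:R :> R &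
    (n.*2.+1 <= covering_number rho (scale cx0 gamma n) Y)%N].
  near=> n; split; near: n.
  - exact: near_scale_lt.
  - exact: near_ln_gt.
  - exact: near_scale_covering hcov0.
(* The squared tent height is [kappa] times the rate; [kappa] involves neither the design nor the
   estimator. *)
pose kappa := (C * 2^-1 `^ beta) ^+ 2 * (2 / cx0) `^ (- (2 * beta / gamma)).
have kappa0 : 0 < kappa.
  by rewrite mulr_gt0 ?powR_gt0 ?exprn_gt0 ?mulr_gt0 ?powR_gt0 ?divr_gt0 ?invr_gt0.
split.
- exists (fun n => uniform_points n.*2 (c n) : probability X R); split.
    by move=> n; exact: uniform_points_all.
  (* A risk of at most kappa/16 times the rate would bound the squared height by 8/16 of itself. *)
  move=> ghat mghat /(_ (kappa / 16)) /(_ (divr_gt0 kappa0 (ltr0n _ 16))) small.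
  have [n [[s01 lnn0 big] risk]] := filter_ex (filterI nlarge small).
  have := minimax_square_bound hmetric hborel hC hbeta0 hbeta1 hf_ge0 mf hf_int
    s01 (proj2 (hc n) big) (mghat n) risk.
  rewrite scale_rate ?(ltW lnn0)// -/kappa.
  have := mulr_gt0 kappa0 (powR_gt0 (- (2 * beta / gamma)) lnn0).
  set u := kappa * _; rewrite [kappa / 16 * _]mulrAC -/u; lra.
(* skip *)
- exists (kappa / 8); split; first by rewrite divr_gt0.
  move=> P PY ghat mghat.
  apply: (@lt_le_trans _ _ (4^-1 : R)%:E); first by rewrite lte_fin.
  apply: limn_einf_ge; near=> n.
  have [s01 lnn0 big] : [/\ 0 < scale cx0 gamma n < 1, 0 < ln n%:R :> R &
    (n.*2.+1 <= covering_number rho (scale cx0 gamma n) Y)%N] by near: n.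
  apply: (minimax_test_bound hmetric hborel hC hbeta0 hbeta1 hf_ge0 mf hf_int
    (Yc n) s01 (proj2 (hc n) big) (mghat n)).
  rewrite scale_rate ?(ltW lnn0)// -/kappa.
  have := mulr_gt0 kappa0 (powR_gt0 (- (2 * beta / gamma)) lnn0).
  set u := kappa * _; rewrite [kappa / 8 * _]mulrAC -/u; lra.
Unshelve. all: by end_near. Qed.
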